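(* Let $F$ be a DeMorgan circuit computing a Boolean function $f:\{0,1\}^n\to\{0,1\}$, and let $\alpha\in\{0,\mathfrak u,1\}^n$ be a prime $0$-witness of $f$. The following are equivalent: (1) $F$ has a $0$-hazard at $\alpha$; (2) $t(\alpha)=\mathfrak u$ for some zero-term $t$ produced by $F$; (3) $c_\alpha$ and $t$ share no literal, for some zero-term $t$ produced by $F$; (4) $c(\alpha)\in\{1,\mathfrak u\}$ for every clause $c$ produced by $F$; (5) the prime implicate $c_\alpha$ of $f$ is not produced by $F$.
   Context: A DeMorgan circuit has fan-in-2 AND/OR gates and inputs $0,1,x_i,\bar x_i$. Literals: $x_i^1=x_i$, $x_i^0=\bar x_i$; term = AND of literals, clause = OR of literals; a zero-term contains some $x_i$ together with $\bar x_i$. Produced terms: at an input gate, the literal/constant itself; at an OR gate, the union of the sets at its two inputs; at an AND gate, all $t_1\land t_2$ with $t_1,t_2$ produced at the two inputs. Produced clauses: at an input gate, the literal/constant itself; at an AND gate, the union; at an OR gate, all $c_1\lor c_2$. The laws $x\bar x=0$, $x\lor\bar x=1$ are not applied. Ternary logic on $\{0,\mathfrak u,1\}$ ($\mathfrak u=1/2$): AND $=\min$, OR $=\max$, NOT $=1-x$. $S_\alpha$: Boolean vectors obtained from $\alpha$ by replacing each $\mathfrak u$ by $0$ or $1$. $F$ has a $0$-hazard at $\alpha$ if $F(a)=0$ for all $a\in S_\alpha$ but $F(\alpha)=\mathfrak u$. $c_\alpha=\bigvee_{i:\alpha_i\ne\mathfrak u}x_i^{1-\alpha_i}$; $\alpha$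 is a prime $0$-witness of $f$ if $c_\alpha$ is a prime implicate of $f$ ($c_\alpha$ is not a one-clause, $f\le c_\alpha$, and no proper subclause $c'$ satisfies $f\le c'$). *)

(* Defs.v *)
From mathcomp Require Import all_boot.

Set Implicit Arguments.
Unset Strict Implicit.
Unset Printing Implicit Defensive.

(* [None] is the unknown value u = 1/2, [Some b] the Boolean value b. *)
Definition tern := option bool.
Definition unk : tern := None.

(* Twice the numerical value of x, so that 0 < u < 1 becomes 0 < 1 < 2. *)
Definition dval (x : tern) : nat :=
  match x with Some false => 0 | None => 1 | Some true => 2 end.

Definition tmin (x y : tern) : tern := if dval x <= dval y then x else y.
Definition tmax (x y : tern) : tern := if dval x <= dval y then y else x.
Definition tneg (x : tern) : tern := omap negb x.

Notation bvec n := {ffun 'I_n -> bool}.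
Notation tvec n := {ffun 'I_n -> tern}.

(* [(i, true)] is x_i and [(i, false)] is its negation. *)
Notation lit n := ('I_n * bool)%type.

Definition blit n (a : bvec n) (l : lit n) : bool :=
  if l.2 then a l.1 else ~~ a l.1.
Definition tlit n (alpha : tvec n) (l : lit n) : tern :=
  if l.2 then alpha l.1 else tneg (alpha l.1).

(* A circuit is a list of gates in topological order; each AND/OR gate refers
   to its two inputs by their positions among the earlier gates, so gates may
   be shared. *)
Inductive gate (n m : nat) : Type :=
| GConst of bool
| GLit of lit n
| GAnd of 'I_m & 'I_m
| GOr of 'I_m & 'I_m.

Inductive gates (n : nat) : nat -> Type :=
| GNil : gates n 0
| GSnoc m : gates n m -> gate n m -> gates n m.+1.

Record circuit (n : nat) : Type := Circuit {
  csize : nat;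
  cgates : gates n csize;
  coutput : 'I_csize
}.

Section Interpretation.
Variables (n : nat) (T : Type).
Variables (vconst : bool -> T) (vlit : lit n -> T) (vand vor : T -> T -> T).

Definition gate_value m (v : m.-tuple T) (g : gate n m) : T :=
  match g with
  | GConst b => vconst b
  | GLit l => vlit l
  | GAnd j k => vand (tnth v j) (tnth v k)
  | GOr j k => vor (tnth v j) (tnth v k)
  end.

Fixpoint gates_values m (G : gates n m) : m.-tuple T :=
  match G with
  | GNil => [tuple]
  | GSnoc _ G' g =>
      let v := gates_values G' in [tuple of rcons v (gate_value v g)]
  end.

Definition interp (F : circuit n) : T :=
  tnth (gates_values (cgates F)) (coutput F).
End Interpretation.

Definition beval n (F : circuit n) (a : bvec n) : bool :=
  interp id (blit a) andb orb F.
Definition teval n (F : circuit n) (alpha : tvec n) : tern :=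
  interp Some (tlit alpha) tmin tmax F.

Definition computes n (F : circuit n) (f : bvec n -> bool) : Prop :=
  forall a, beval F a = f a.

(* Terms and clauses are sets of literals; the empty term is the constant 1
   and the empty clause is the constant 0. *)
Notation term n := {set lit n}.
Notation clause n := {set lit n}.

Definition tclause n (alpha : tvec n) (c : clause n) : tern :=
  \big[tmax/Some false]_(l in c) tlit alpha l.
Definition tterm n (alpha : tvec n) (t : term n) : tern :=
  \big[tmin/Some true]_(l in t) tlit alpha l.
Definition bclause n (a : bvec n) (c : clause n) : bool :=
  \big[orb/false]_(l in c) blit a l.

Definition zero_term n (t : term n) : bool :=
  [exists i, ((i, true) \in t) && ((i, false) \in t)].
Definition one_clause n (c : clause n) : bool :=
  [exists i, ((i, true) \in c) && ((i, false) \in c)].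

(* Besides associativity, commutativity and idempotence, the laws for
   constants (1 /\ t = t, 0 /\ t = 0, 0 \/ c = c, 1 \/ c = 1) do apply to
   produced terms and clauses.  Hence a produced term is either [Some t] or
   the constant 0, coded by [None]; a produced clause is either [Some c] or
   the constant 1, coded by [None]. *)
Definition join n (s1 s2 : option {set lit n}) : option {set lit n} :=
  if s1 is Some A then if s2 is Some B then Some (A :|: B) else None else None.

Definition const_term n (b : bool) : option (term n) :=
  if b then Some set0 else None.
Definition const_clause n (b : bool) : option (clause n) :=
  if b then None else Some set0.

Definition produced_terms n (F : circuit n) : {set option (term n)} :=
  interp (fun b => [set const_term n b]) (fun l => [set Some [set l]])
    (fun A B => [set join t1 t2 | t1 in A, t2 in B])
    (fun A B => A :|: B) F.
Definition produced_clauses n (F : circuit n) : {set option (clause n)} :=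
  interp (fun b => [set const_clause n b]) (fun l => [set Some [set l]])
    (fun A B => A :|: B)
    (fun A B => [set join c1 c2 | c1 in A, c2 in B]) F.

Definition tclause_opt n (alpha : tvec n) (c : option (clause n)) : tern :=
  if c is Some c' then tclause alpha c' else Some true.

Definition resolutions n (alpha : tvec n) : {set bvec n} :=
  [set a : bvec n | [forall i, (alpha i != unk) ==> (alpha i == Some (a i))]].

Definition hazard0 n (F : circuit n) (alpha : tvec n) : Prop :=
  (forall a, a \in resolutions alpha -> beval F a = false)
  /\ teval F alpha = unk.

Definition implicate n (f : bvec n -> bool) (c : clause n) : Prop :=
  forall a, f a -> bclause a c.

Definition prime_implicate n (f : bvec n -> bool) (c : clause n) : Prop :=
  [/\ ~~ one_clause c, implicate f c
    & forall c' : clause n, c' \proper c -> ~ implicate f c'].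

(* The literals x_i^(1 - alpha_i) over all i with alpha_i <> u. *)
Definition witness_clause n (alpha : tvec n) : clause n :=
  [set l : lit n | alpha l.1 == Some (~~ l.2)].

Definition prime_0witness n (f : bvec n -> bool) (alpha : tvec n) : Prop :=
  prime_implicate f (witness_clause alpha).

(* Main.v *)
(** Both the produced terms and the produced clauses compute [F] under every
   Boolean valuation of the [2n] literals, even one that is inconsistent on x_i
   and its negation, because the laws for x_i and its negation are not used.
   A ternary vector is a pair of such valuations ("the literal is 1" and "the
   literal is not 0"), and the literals of a produced term [t] form another one,
   so that every produced clause shares a literal with [t].  A produced term
   that is not 0 at [alpha] and is not a zero-term is 1 at some resolution of
   [alpha]; and a produced clause that is 0 at [alpha] is an implicate inside
   [c_alpha], hence is [c_alpha] by primality. *)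

Require Import Defs.
From mathcomp Require Import all_boot.

Section InterpRel.
Variables (n : nat) (T1 T2 : Type) (R : T1 -> T2 -> Prop).
Variables (const1 : bool -> T1) (lit1 : lit n -> T1) (and1 or1 : T1 -> T1 -> T1).
Variables (const2 : bool -> T2) (lit2 : lit n -> T2) (and2 or2 : T2 -> T2 -> T2).
Hypothesis Rconst : forall b, R (const1 b) (const2 b).
Hypothesis Rlit : forall l, R (lit1 l) (lit2 l).
Hypothesis Rand : forall x1 x2 y1 y2,
  R x1 x2 -> R y1 y2 -> R (and1 x1 y1) (and2 x2 y2).
Hypothesis Ror : forall x1 x2 y1 y2,
  R x1 x2 -> R y1 y2 -> R (or1 x1 y1) (or2 x2 y2).

(** A logical-relation argument by induction on the gate list: appending a gate keeps all earlier
    values, and the new one is built from related values. *)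
Lemma interp_rel (F : circuit n) :
  R (interp const1 lit1 and1 or1 F) (interp const2 lit2 and2 or2 F).
Proof.
case: F => m G out; rewrite /interp /=.
elim: G out => [|k G IH g] out /=; first by case: out.
set v1 := gates_values _ _ _ _ G in IH *; set v2 := gates_values _ _ _ _ G in IH *.
(* The defaults only serve to pass from [tnth] to [nth]; every position is in range. *)
rewrite !(tnth_nth (const1 true)) !(tnth_nth (const2 true)) /= !nth_rcons !size_tuple.
have := ltn_ord out; case: (ltngtP out k) => [lt_out _|lt_out|_ _].
- by have := IH (Ordinal lt_out);
     rewrite (tnth_nth (const1 true)) (tnth_nth (const2 true)).
- by rewrite ltnS leqNgt lt_out.
- by case: g => [b|l|i j|i j] /=; [exact: Rconst | exact: Rlit
    | exact: Rand | exact: Ror].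
Qed.

End InterpRel.

(** The circuit read as a monotone one over 2n independent inputs, [P] being the set of inputs equal
    to 1. *)
Definition lit_eval {n} (P : {set lit n}) (F : circuit n) : bool :=
  interp id (mem P) andb orb F.

(** Distributivity alone expands the monotone circuit into the disjunction of its produced terms;
    [None], the constant 0, never satisfies it. *)
Lemma lit_evalE_terms {n} (P : {set lit n}) (F : circuit n) :
  lit_eval P F <-> exists2 t, Some t \in produced_terms F & t \subset P.
Proof.
apply: (interp_rel n bool {set option (term n)}
  (fun b A => b <-> exists2 t, Some t \in A & t \subset P)).
- move=> []; last by split=> // -[t]; rewrite inE.
  by split=> // _; exists set0; rewrite ?inE ?sub0set.
- move=> l; split=> [Pl|[t]]; first by exists [set l]; rewrite ?sub1set ?inE.
  by rewrite inE => /eqP[->]; rewrite sub1set.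
- move=> x A y B xA yB; split=> [/andP[/xA[t tA tP] /yB[s sB sP]]|[t]].
    exists (t :|: s); last by rewrite subUset tP.
    by apply/imset2P; exists (Some t) (Some s).
  case/imset2P=> -[t1|] [t2|] // t1A t2B [->]; rewrite subUset => /andP[t1P t2P].
  by apply/andP; split; [apply/xA; exists t1 | apply/yB; exists t2].
- move=> x A y B xA yB; split=> [/orP[/xA|/yB] [t tA tP]|[t]].
  + by exists t; rewrite ?inE ?tA.
  + by exists t; rewrite ?inE ?tA ?orbT.
  + rewrite inE => /orP[tA|tB] tP; apply/orP; [left; apply/xA | right; apply/yB];
      by exists t.
Qed.

Lemma lit_evalE_clauses {n} (P : {set lit n}) (F : circuit n) :
  ~~ lit_eval P F <->
  exists2 c, Some c \in produced_clauses F & c \subset ~: P.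
Proof.
apply: (interp_rel n bool {set option (clause n)}
  (fun b A => ~~ b <-> exists2 c, Some c \in A & c \subset ~: P)).
- move=> []; first by split=> // -[c]; rewrite inE.
  by split=> // _; exists set0; rewrite ?inE ?sub0set.
- move=> l; split=> [Pl|[c]]; first by exists [set l]; rewrite ?sub1set ?inE.
  by rewrite inE => /eqP[->]; rewrite sub1set inE.
- move=> x A y B xA yB; rewrite negb_and; split=> [/orP[/xA|/yB] [c cA cP]|[c]].
  + by exists c; rewrite ?inE ?cA.
  + by exists c; rewrite ?inE ?cA ?orbT.
  + rewrite inE => /orP[cA|cB] cP; apply/orP; [left; apply/xA | right; apply/yB];
      by exists c.
- move=> x A y B xA yB; rewrite negb_or.
  split=> [/andP[/xA[c cA cP] /yB[d dB dP]]|[c]].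
    exists (c :|: d); last by rewrite subUset cP.
    by apply/imset2P; exists (Some c) (Some d).
  case/imset2P=> -[c1|] [c2|] // c1A c2B [->]; rewrite subUset => /andP[c1P c2P].
  by apply/andP; split; [apply/xA; exists c1 | apply/yB; exists c2].
Qed.

Lemma produced_term_meets_clause {n} (F : circuit n) (t : term n) (c : clause n) :
  Some t \in produced_terms F -> Some c \in produced_clauses F ->
  exists2 l, l \in t & l \in c.
Proof.
move=> tF cF; have Ft : lit_eval t F by apply/lit_evalE_terms; exists t.
have : ~~ (c \subset ~: t).
  by apply: contraL Ft => ct; apply/lit_evalE_clauses; exists c.
by case/subsetPn=> l lc; rewrite !inE negbK => lt; exists l.
Qed.

Definition true_lits {n} (a : bvec n) : {set lit n} := [set l | blit a l].

Lemma lit_eval_true_lits {n} (a : bvec n) (F : circuit n) :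
  lit_eval (true_lits a) F = beval F a.
Proof.
apply: (interp_rel n bool bool eq) => //; first by move=> l; rewrite /= inE.
- by move=> x _ y _ <- <-.
- by move=> x _ y _ <- <-.
Qed.

Section Ternary.
Context {n : nat} (alpha : tvec n).

(** The two thresholds of the chain 0 < u < 1. Each threshold map commutes with min and max, and
    together they determine a ternary value. *)
Definition must : {set lit n} := [set l | tlit alpha l == Some true].
Definition may : {set lit n} := [set l | tlit alpha l != Some false].

Lemma teval_must (F : circuit n) : (teval F alpha == Some true) = lit_eval must F.
Proof.
apply: (interp_rel n tern bool (fun x b => (x == Some true) = b)).
- by case.
- by move=> l; rewrite /= inE.
- by move=> [[]|] _ [[]|] _ <- <-.
- by move=> [[]|] _ [[]|] _ <- <-.
Qed.

Lemma teval_may (F : circuit n) : (teval F alpha != Some false) = lit_eval may F.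
Proof.
apply: (interp_rel n tern bool (fun x b => (x != Some false) = b)).
- by case.
- by move=> l; rewrite /= inE.
- by move=> [[]|] _ [[]|] _ <- <-.
- by move=> [[]|] _ [[]|] _ <- <-.
Qed.

Lemma tterm_must (t : term n) : (tterm alpha t == Some true) = (t \subset must).
Proof.
rewrite /tterm (big_morph (fun x => x == Some true) (id1 := true) (op1 := andb)) //.
  by rewrite big_andE; apply/forall_inP/subsetP=> tP l /tP; rewrite inE.
by move=> [[]|] [[]|].
Qed.

Lemma tterm_may (t : term n) : (tterm alpha t != Some false) = (t \subset may).
Proof.
rewrite /tterm (big_morph (fun x => x != Some false) (id1 := true) (op1 := andb)) //.
  by rewrite big_andE; apply/forall_inP/subsetP=> tP l /tP; rewrite inE.
by move=> [[]|] [[]|].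
Qed.

Lemma tclause_may (c : clause n) :
  (tclause alpha c != Some false) = [exists l in c, l \in may].
Proof.
rewrite /tclause (big_morph (fun x => x != Some false) (id1 := false) (op1 := orb)) //.
  by rewrite big_orE; apply: eq_existsb => l; rewrite inE.
by move=> [[]|] [[]|].
Qed.

(** This turns a clause that avoids [may] into a subclause of c_alpha, to which primality
    applies. *)
Lemma in_witness_clause (l : lit n) : (l \in witness_clause alpha) = (l \notin may).
Proof. by rewrite !inE /tlit; case: l => i [] /=; case: (alpha i) => [[]|]. Qed.

Lemma resolution_blit (a : bvec n) (l : lit n) :
  a \in resolutions alpha -> l \notin may -> blit a l = false.
Proof.
rewrite !inE => /forallP/(_ l.1); rewrite /tlit /blit.
by case: l => i [] /=; case: (alpha i) => [[]|] //=; case: (a i).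
Qed.

Lemma resolution_must (a : bvec n) (l : lit n) :
  a \in resolutions alpha -> l \in must -> blit a l.
Proof.
rewrite !inE => /forallP/(_ l.1); rewrite /tlit /blit.
by case: l => i [] /=; case: (alpha i) => [[]|] //=; case: (a i).
Qed.

Lemma resolution_exists (t : term n) :
  ~~ zero_term t -> t \subset may ->
  exists2 a, a \in resolutions alpha & t \subset true_lits a.
Proof.
move=> /existsPn nz /subsetP tmay.
(* An unknown x_i becomes 1 exactly when x_i occurs in [t]; if its negation occurs instead, x_i does
   not, and the value 0 is the right one. *)
exists [ffun i => if alpha i is Some b then b else (i, true) \in t].
  rewrite inE; apply/forallP=> i; rewrite ffunE.
  by case: (alpha i) => [b|] //=; rewrite eqxx implybT.
apply/subsetP=> -[i b] lt; have := tmay _ lt; have := nz i.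
rewrite !inE /tlit /blit /= ffunE.
by case: b lt => lt /=; case: (alpha i) => [[]|] //=; rewrite ?lt ?andbT.
Qed.

Lemma resolutions_witness_clause (a : bvec n) :
  a \in resolutions alpha -> bclause a (witness_clause alpha) = false.
Proof.
move=> aS; rewrite /bclause big_orE; apply/negbTE/exists_inPn=> l.
by rewrite in_witness_clause => /(resolution_blit _ _ aS) ->.
Qed.

End Ternary.

Lemma resolutions_nonempty {n} (alpha : tvec n) : exists a, a \in resolutions alpha.
Proof.
have [||a aS _] := resolution_exists alpha set0; last by exists a.
- by apply/existsPn=> i; rewrite !inE.
- exact: sub0set.
Qed.

(** A produced clause false at [a] avoids [true_lits a], which forces the circuit to 0 at [a]. *)
Lemma produced_clause_implicate {n} (F : circuit n) (f : bvec n -> bool) (c : clause n) :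
  computes F f -> Some c \in produced_clauses F -> implicate f c.
Proof.
move=> hF cF a; rewrite -hF; apply: contraTT; rewrite /bclause big_orE => cN.
rewrite -lit_eval_true_lits; apply/lit_evalE_clauses; exists c => //.
apply/subsetP=> l lc; rewrite !inE; apply: contra cN => al.
by apply/exists_inP; exists l.
Qed.

Theorem theorem6 (n : nat) (F : circuit n) (f : bvec n -> bool)
    (alpha : tvec n)
    (hF : computes F f) (halpha : prime_0witness f alpha) :
  [<-> hazard0 F alpha;
       exists t : term n,
         [/\ Some t \in produced_terms F, zero_term t & tterm alpha t = unk];
       exists t : term n,
         [/\ Some t \in produced_terms F, zero_term t
           & [disjoint witness_clause alpha & t]];
       forall c : option (clause n), c \in produced_clauses F ->
         tclause_opt alpha c = Some true \/ tclause_opt alpha c = unk;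
       Some (witness_clause alpha) \notin produced_clauses F].
Proof.
have [_ impl prime] := halpha.
(* The Boolean half of the hazard holds at every prime 0-witness, so only the value at [alpha] is at
   stake below. *)
have F0 a : a \in resolutions alpha -> beval F a = false.
  move=> /(resolutions_witness_clause alpha a) ca; rewrite hF.
  by apply/negP=> /impl; rewrite ca.
have termF a t : Some t \in produced_terms F -> t \subset true_lits a -> beval F a.
  by move=> tF ta; rewrite -lit_eval_true_lits; apply/lit_evalE_terms; exists t.
tfae.
- case=> _ Fu; have : lit_eval (may alpha) F by rewrite -teval_may Fu.
  case/lit_evalE_terms=> t tF tmay; exists t; split=> //.
    case: (boolP (zero_term t)) => // /resolution_exists/(_ tmay)[a aS ta].
    by have := F0 a aS; rewrite (termF a t).
  have := tterm_may alpha t; have := tterm_must alpha t; rewrite tmay.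
  (* A produced term equal to 1 at [alpha] would force the circuit to 1 there. *)
  have -> : (t \subset must alpha) = false.
    apply/negP=> tmust; have : lit_eval (must alpha) F.
      by apply/lit_evalE_terms; exists t.
    by rewrite -teval_must Fu.
  by case: (tterm alpha t) => [[]|].
- case=> t [tF tz tu]; exists t; split=> //.
  have /subsetP tmay : t \subset may alpha by rewrite -tterm_may tu.
  rewrite disjoint_sym disjoints_subset; apply/subsetP=> l /tmay lmay.
  by rewrite inE in_witness_clause negbK.
- case=> t [tF _ dis] [c|] cF /=; last by left.
  (* The common literal lies in [t], hence outside c_alpha, so it is not 0 at [alpha]. *)
  have [l lt lc] := produced_term_meets_clause F t c tF cF.
  have : tclause alpha c != Some false.
    rewrite tclause_may; apply/exists_inP; exists l => //.
    by rewrite -[_ \in _]negbK -in_witness_clause (disjointFl dis).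
  by case: (tclause alpha c) => [[]|]; [left | | right].
- move=> H; apply/negP=> /H /=.
  have : ~~ (tclause alpha (witness_clause alpha) != Some false).
    rewrite tclause_may; apply/exists_inPn=> l.
    by rewrite in_witness_clause.
  by rewrite negbK => /eqP -> [].
- move=> npr; split=> //.
  (* The value 1 would persist at every resolution, where the circuit is 0; the value 0 would yield
     a produced clause inside c_alpha. *)
  case E: (teval F alpha) => [[]|] //.
    have : lit_eval (must alpha) F by rewrite -teval_must E.
    case/lit_evalE_terms=> t tF /subsetP tmust.
    have [a aS] := resolutions_nonempty alpha.
    have := F0 a aS; rewrite (termF a t) //.
    by apply/subsetP=> l /tmust/(resolution_must alpha a l aS); rewrite inE.
  have : ~~ lit_eval (may alpha) F by rewrite -teval_may E.
  case/lit_evalE_clauses=> c cF /subsetP cN.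
  have : c \subset witness_clause alpha.
    by apply/subsetP=> l /cN; rewrite inE in_witness_clause.
  rewrite subEproper => /orP[/eqP eq_c|/prime[]]; first by rewrite -eq_c cF in npr.
  exact: (produced_clause_implicate F).
Qed.
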